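(* Let $a\in\mathbb{N}=\{1,2,\ldots\}$, let $m\ge1$ be an integer, and let $0\le\alpha_1\le\alpha_2\le\cdots\le\alpha_m$ be real numbers such that $$\big([a,\alpha_m)\cap\mathbb{N}\big)\subset\{\alpha_1,\alpha_2,\ldots,\alpha_m\}.$$ Then the sequence $$\left(\frac{(a)_k}{k!}(k+\alpha_1)(k+\alpha_2)\cdots(k+\alpha_m)\right)_{k=0}^{\infty}$$ is totally positive.
   Context: $(a)_k=a(a+1)\cdots(a+k-1)$, $(a)_0=1$, is the Pochhammer symbol. A real sequence $(a_k)_{k=0}^\infty$ is called totally positive (or a Pólya frequency sequence) if all minors of the infinite upper triangular Toeplitz matrix $\|a_{j-i}\|_{i,j\ge0}$ (with $a_k=0$ for $k<0$) are nonnegative. *)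

(* Defs.v *)
(* MathComp world; the reals are an arbitrary [R : realType]. *)
From mathcomp Require Import all_boot all_order all_algebra.
From mathcomp Require Import reals.

Set Implicit Arguments.
Unset Strict Implicit.
Unset Printing Implicit Defensive.

Import Order.TTheory GRing.Theory Num.Theory.
Local Open Scope ring_scope.

Definition pochhammer (R : realType) (x : R) (k : nat) : R :=
  \prod_(0 <= i < k) (x + i%:R).

(* [j - i] is truncated subtraction, so the convention u_k = 0 for k < 0 has
   to be imposed explicitly. *)
Definition toeplitz (R : realType) (u : nat -> R) (i j : nat) : R :=
  if (i <= j)%N then u (j - i)%N else 0.

(* A minor of order n is given by strictly increasing row and column
   selections r and c; the empty minor n = 0 has value 1. *)
Definition totally_positive (R : realType) (u : nat -> R) : Prop :=
  forall (n : nat) (r c : 'I_n -> nat),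
    (forall i j : 'I_n, (i < j)%N -> (r i < r j)%N) ->
    (forall i j : 'I_n, (i < j)%N -> (c i < c j)%N) ->
    0 <= \det (\matrix_(i < n, j < n) toeplitz u (r i) (c j)).

(* Main.v *)
Require Import Defs.
From mathcomp Require Import all_boot all_order all_algebra.
From mathcomp Require Import reals.
From mathcomp Require Import ring lra zify.
From mathcomp Require Import polyrcf.

(** Why the theorem holds.  The sequence (a)_k / k! has generating function
    1 / (1 - x)^a.  Multiplying the k-th term by (k + al) applies the operator
    x d/dx + al to the generating function, and sends P / (1 - x)^b to
    Q / (1 - x)^(b + 1), where
      Q = (1 - x) (x P' + al P) + b x P
    ([weight_step], [gf_coef_weight_step]).

    Suppose that P has degree d, positive leading coefficient and d distinct
    roots, all negative, and that al > 0.  At a root -t of P the value of Q is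
    -t (1 + t) P'(-t), so Q changes sign between consecutive roots of P, and
    also between the root closest to 0 and 0 itself: this gives d distinct
    negative roots.  The coefficient of Q in degree d + 1 is that of P in
    degree d times b - d - al.  If al = b - d, then Q has degree d and all its
    roots have been found; if al < b - d, then the sign of Q at minus infinity
    yields one more root, to the left of the others.  In both cases Q has the
    same form as P ([neg_rooted_step]).

    The level b - d starts at a; it stays the same after a weight al < b - d
    and increases by 1 after a weight al = b - d.  A weight al > b - d never
    occurs when the weights are taken in increasing order: the hypothesis says
    that every integer of [a, alpha_m) is one of the weights, so the integer
    b - d would be a weight smaller than al that has not been met
    ([weights_neg_rooted]).  When alpha_1 = 0, the sequence is a shift of the
    one with a + 1 and the weights alpha_2 + 1, ..., alpha_m + 1, so that the
    weights may be assumed positive.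

    Hence the generating function is c (x + s_1) ... (x + s_d) / (1 - x)^b with
    c, s_1, ..., s_d positive.  Total positivity of such a sequence follows
    because it is preserved by u_k |-> s u_k + t u_(k-1) with s, t >= 0
    ([totally_positive_two_term]) and by partial sums
    ([totally_positive_partial_sum]); both are proved by replacing the columns
    of a minor one at a time and expanding multilinearly. *)

Set Implicit Arguments.
Unset Strict Implicit.
Unset Printing Implicit Defensive.

Import Order.TTheory GRing.Theory Num.Theory.
Local Open Scope ring_scope.

(** * Families of vectors with nonnegative maximal minors *)

Definition increasing n (c : 'I_n -> nat) :=
  forall i j : 'I_n, (i < j)%N -> (c i < c j)%N.

(** The maximal minors of the n x oo matrix whose columns are A_0, A_1, ... are
    nonnegative.  The columns are stored as row vectors, because the
    determinant is multilinear and alternating in rows. *)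
Definition minors_nonneg (R : realType) n (A : nat -> 'rV[R]_n) :=
  forall c : 'I_n -> nat, increasing c -> 0 <= \det (\matrix_(j < n) A (c j)).

Lemma det_row_linear (R : comPzRingType) n (G : 'I_n -> 'rV[R]_n) (k : 'I_n)
    (x y z : 'rV[R]_n) (s t : R) :
  z = s *: x + t *: y ->
  \det (\matrix_(j < n) (if j == k then z else G j)) =
  s * \det (\matrix_(j < n) (if j == k then x else G j)) +
  t * \det (\matrix_(j < n) (if j == k then y else G j)).
Proof.
move=> zE; apply: (@determinant_multilinear _ _ _ _ _ k).
- by rewrite !rowK !eqxx.
- by apply/matrixP => i l; rewrite !mxE eq_sym (negbTE (neq_lift _ _)).
- by apply/matrixP => i l; rewrite !mxE eq_sym (negbTE (neq_lift _ _)).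
Qed.

Lemma det_repeated_row (R : comPzRingType) n (F : 'I_n -> 'rV[R]_n) (i k : 'I_n) :
  i != k -> F i = F k -> \det (\matrix_(j < n) F j) = 0.
Proof. by move=> ik e; apply: (determinant_alternate ik) => l; rewrite !mxE e. Qed.

(** Lowering one value of an increasing selection keeps it increasing, as long
    as the value stays above the preceding ones. *)
Lemma increasing_upd n (c : 'I_n -> nat) (k : 'I_n) (v : nat) :
  increasing c -> (v <= c k)%N -> (forall j : 'I_n, (j < k)%N -> (c j < v)%N) ->
  increasing (fun j => if j == k then v else c j).
Proof.
move=> cI vk lo i j ij.
case: (eqVneq i k) => [ik|ik]; case: (eqVneq j k) => [jk|jk].
- by move: ij; rewrite ik jk ltnn.
- by apply: leq_ltn_trans vk _; rewrite -ik; apply: cI.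
- by apply: lo; rewrite -jk.
- exact: cI.
Qed.

Lemma minors_nonneg_two_term (R : realType) n (A B : nat -> 'rV[R]_n) (s t : R) :
  0 <= s -> 0 <= t -> B 0%N = s *: A 0%N ->
  (forall k, B k.+1 = s *: A k.+1 + t *: A k) ->
  minors_nonneg A -> minors_nonneg B.
Proof.
move=> s0 t0 B0 BS tpA.
(* Rows are switched from A to B starting with the last one: the part t * A_v
   of the new row, with v = c_k - 1, then either repeats the preceding row,
   which is still taken from A, or keeps the selection increasing. *)
pose H k (c : 'I_n -> nat) (j : 'I_n) := if (j < k)%N then A (c j) else B (c j).
suff main q c : increasing c -> 0 <= \det (\matrix_(j < n) H (n - q)%N c j).
  move=> c cI; have := main n c cI; congr (0 <= \det _).
  by apply/row_matrixP => i; rewrite !rowK /H subnn.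
elim: q c => [|q IH] c cI.
  rewrite (_ : \matrix_ _ _ = \matrix_(j < n) A (c j)); first exact: tpA.
  by apply/row_matrixP => i; rewrite !rowK /H subn0 ltn_ord.
case: (leqP n q) => [nq|qn].
  by rewrite (_ : (n - q.+1)%N = (n - q)%N); [exact: IH | lia].
have kn : (n - q.+1 < n)%N by lia.
pose k := Ordinal kn.
have kS : (n - q)%N = k.+1 by rewrite /=; lia.
rewrite kS in IH.
rewrite -[(n - q.+1)%N]/(k : nat).
have updE X : X = B (c k) -> \matrix_(j < n) H k c j =
    \matrix_(j < n) (if j == k then X else H k.+1 c j).
  move=> ->; apply/row_matrixP => i; rewrite !rowK /H.
  case: eqVneq => [->|ik]; first by rewrite ltnn.
  by rewrite ltnS [(i <= k)%N]leq_eqVlt -[_ == _ :> nat]/(i == k) (negbTE ik).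
have keep : \matrix_(j < n) (if j == k then A (c k) else H k.+1 c j) =
    \matrix_(j < n) H k.+1 c j.
  apply/row_matrixP => i; rewrite !rowK /H.
  by case: eqVneq => [->|//]; rewrite ltnS leqnn.
case ck : (c k) => [|v].
  rewrite (updE (s *: A (c k) + 0 *: A 0%N)); last by rewrite ck scale0r addr0 B0.
  by rewrite (det_row_linear (R:=R) _ _ erefl) mul0r addr0 keep mulr_ge0 ?IH.
rewrite (updE (s *: A (c k) + t *: A v)); last by rewrite ck BS.
rewrite (det_row_linear (R:=R) _ _ erefl) keep addr_ge0 // mulr_ge0 ?IH //.
case: (boolP [exists j : 'I_n, (j < k)%N && (c j == v)]) =>
    [/existsP[j /andP[jk /eqP cj]]|no].
  have jk' : j != k by apply: contraTneq jk => ->; rewrite ltnn.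
  rewrite (det_repeated_row jk') // (negbTE jk') eqxx /H ltnS (ltnW jk).
  by rewrite cj.
have lo (j : 'I_n) : (j < k)%N -> (c j < v)%N.
  move=> jk; have := cI _ _ jk; rewrite ck ltnS leq_eqVlt => /orP[e|//].
  by case/negP: no; apply/existsP; exists j; rewrite jk.
have := IH _ (increasing_upd (v := v) cI _ lo); rewrite ck leqnSn => /(_ isT).
congr (0 <= \det _); apply/row_matrixP => i; rewrite !rowK /H.
by case: eqVneq => [->|//]; rewrite ltnS leqnn.
Qed.

Lemma minors_nonneg_partial_sum (R : realType) n (A B : nat -> 'rV[R]_n) :
  B 0%N = A 0%N -> (forall k, B k.+1 = B k + A k.+1) ->
  minors_nonneg A -> minors_nonneg B.
Proof.
move=> B0 BS tpA.
(* Rows are switched from A to the partial sums B starting with the first one: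
   in row k, the part of the sum up to the index chosen in row k - 1 repeats
   that row, and every further term A_v keeps the selection increasing. *)
pose H k (c : 'I_n -> nat) (j : 'I_n) := if (j < k)%N then B (c j) else A (c j).
suff main k c : increasing c -> 0 <= \det (\matrix_(j < n) H k c j).
  move=> c cI; have := main n c cI; congr (0 <= \det _).
  by apply/row_matrixP => i; rewrite !rowK /H ltn_ord.
elim: k c => [|k0 IH] c cI.
  rewrite (_ : \matrix_ _ _ = \matrix_(j < n) A (c j)); first exact: tpA.
  by apply/row_matrixP => i; rewrite !rowK /H.
case: (leqP n k0) => [nk|kn].
  have := IH c cI; congr (0 <= \det _); apply/row_matrixP => i; rewrite !rowK /H.
  have ik := leq_trans (ltn_ord i) nk.
  by rewrite ltnS ik (ltnW ik).
pose k := Ordinal kn; rewrite -[k0]/(k : nat) in IH *.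
pose G v := \matrix_(j < n) (if j == k then B v else H k c j).
have -> : \matrix_(j < n) H k.+1 c j = G (c k).
  apply/row_matrixP => i; rewrite !rowK /H.
  case: eqVneq => [->|ik]; first by rewrite ltnS leqnn.
  by rewrite ltnS leq_eqVlt -[_ == _ :> nat]/(i == k) (negbTE ik).
have old v : (v <= c k)%N -> (forall j : 'I_n, (j < k)%N -> (c j < v)%N) ->
    0 <= \det (\matrix_(j < n) (if j == k then A v else H k c j)).
  move=> vk lo; have := IH _ (increasing_upd cI vk lo).
  congr (0 <= \det _); apply/row_matrixP => i; rewrite !rowK /H.
  by case: eqVneq => [->|//]; rewrite ltnn.
(* With B_v in row k, either an earlier row is also B_v or all the earlier
   indices lie below v. *)
have dich v : (forall j : 'I_n, (j < k)%N -> (c j <= v)%N) ->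
    \det (G v) = 0 \/ forall j : 'I_n, (j < k)%N -> (c j < v)%N.
  move=> lo.
  case: (boolP [exists j : 'I_n, (j < k)%N && (c j == v)]) =>
    [/existsP[j /andP[jk /eqP cj]]|no].
    have jk' : j != k by apply: contraTneq jk => ->; rewrite ltnn.
    by left; rewrite /G (det_repeated_row jk') // (negbTE jk') eqxx /H jk cj.
  right=> j jk; have := lo _ jk; rewrite leq_eqVlt => /orP[e|//].
  by case/negP: no; apply/existsP; exists j; rewrite jk.
suff main v : (v <= c k)%N -> (forall j : 'I_n, (j < k)%N -> (c j <= v)%N) ->
    0 <= \det (G v).
  by apply: main => // j jk; apply/ltnW/cI.
elim: v => [|v IHv] vk /dich[->//|lo].
  by rewrite /G B0; apply: old.
rewrite /G (@det_row_linear _ _ _ k (B v) (A v.+1) _ 1 1); last by rewrite !scale1r.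
rewrite !mul1r addr_ge0 ?old //; apply: IHv; first exact: ltnW.
by move=> j /lo.
Qed.

(** * Operations that preserve total positivity *)

Lemma eq_totally_positive (R : realType) (u w : nat -> R) :
  u =1 w -> totally_positive u -> totally_positive w.
Proof.
move=> e tp n r c rI cI; have := tp n r c rI cI; congr (0 <= \det _).
by apply/matrixP => i j; rewrite !mxE /toeplitz e.
Qed.

Lemma totally_positiveP (R : realType) (u : nat -> R) :
  totally_positive u <->
  forall n (r : 'I_n -> nat), increasing r ->
    minors_nonneg (fun j => \row_(i < n) toeplitz u (r i) j).
Proof.
have E n (r c : 'I_n -> nat) : \det (\matrix_(i < n, j < n) toeplitz u (r i) (c j)) =
    \det (\matrix_(j < n) \row_(i < n) toeplitz u (r i) (c j)).
  by rewrite -det_tr; congr (\det _); apply/matrixP => i j; rewrite !mxE.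
split=> [tp n r rI c cI|tp n r c rI cI]; first by rewrite -E; apply: tp.
by rewrite E; apply: tp.
Qed.

(** Multiplication of the generating function by s + t x.  The case t = 0 is
    scaling and the case s = 0, t = 1 is the shift to the right. *)
Lemma totally_positive_two_term (R : realType) (u w : nat -> R) (s t : R) :
  0 <= s -> 0 <= t -> w 0%N = s * u 0%N ->
  (forall k, w k.+1 = s * u k.+1 + t * u k) ->
  totally_positive u -> totally_positive w.
Proof.
move=> s0 t0 w0 wS /totally_positiveP tp; apply/totally_positiveP => n r rI.
apply: (minors_nonneg_two_term s0 t0) (tp n r rI) => [|k].
  by apply/rowP => i; rewrite !mxE /toeplitz; case: ifP => _; rewrite ?mulr0 ?sub0n.
apply/rowP => i; rewrite !mxE /toeplitz.
case: (ltngtP (r i) k.+1) => [ik|ki|->].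
- by rewrite -ltnS ik subSn // wS.
- by rewrite leqNgt (ltnW ki) /= !mulr0 addr0.
- by rewrite ltnn subnn w0 mulr0 addr0.
Qed.

(** Multiplication of the generating function by 1 / (1 - x). *)
Lemma totally_positive_partial_sum (R : realType) (u w : nat -> R) :
  w 0%N = u 0%N -> (forall k, w k.+1 = w k + u k.+1) ->
  totally_positive u -> totally_positive w.
Proof.
move=> w0 wS /totally_positiveP tp; apply/totally_positiveP => n r rI.
apply: (minors_nonneg_partial_sum) (tp n r rI) => [|k].
  by apply/rowP => i; rewrite !mxE /toeplitz sub0n w0.
apply/rowP => i; rewrite !mxE /toeplitz.
case: (ltngtP (r i) k.+1) => [ik|ki|->].
- by rewrite -ltnS ik subSn // wS.
- by rewrite leqNgt (ltnW ki) /= addr0.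
- by rewrite ltnn subnn w0 add0r.
Qed.

Lemma totally_positive_delta (R : realType) :
  totally_positive (fun k : nat => (k == 0%N)%:R : R).
Proof.
move=> n r c rI cI.
have E i j : toeplitz (fun k : nat => (k == 0%N)%:R : R) i j = (i == j)%:R.
  rewrite /toeplitz; case: (ltngtP i j) => [ij|//|->]; last by rewrite subnn.
  by rewrite subn_eq0 leqNgt ij.
set M := \matrix_(_, _) _.
have ME i j : M i j = (r i == c j)%:R by rewrite mxE E.
(* At the first i where the selections differ, row i (if r_i < c_i) or column i
   (if c_i < r_i) of the minor vanishes. *)
case: (boolP [forall i, r i == c i]) => [/forallP rc|].
  rewrite (_ : M = 1%:M) ?det1 //; apply/matrixP => i j.
  rewrite ME mxE (eqP (rc i)); congr (_%:R); congr nat_of_bool.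
  apply/eqP/eqP => [e|-> //]; apply/val_inj.
  by case: (ltngtP i j) => // /cI; rewrite e ltnn.
rewrite negb_forall => /existsP[i0 rci0].
case: (@arg_minnP _ i0 (fun i => r i != c i) val rci0) => i rci imin.
have before (j : 'I_n) : (j < i)%N -> r j = c j.
  by move=> ji; apply/eqP; apply: contraTT ji => /imin; rewrite -leqNgt.
suff -> : \det M = 0 by [].
case: (ltngtP (r i) (c i)) rci => // [lt|gt] _.
  rewrite (expand_det_row _ i) big1 // => j _; rewrite ME.
  case: eqP => [e|_]; last by rewrite mul0r.
  case: (ltngtP j i) => [ji|ij|ji].
  - by have := rI _ _ ji; rewrite (before j ji) e ltnn.
  - by have := ltn_trans lt (cI _ _ ij); rewrite e ltnn.
  - by move: lt; rewrite e (val_inj ji) ltnn.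
rewrite (expand_det_col _ i) big1 // => j _; rewrite ME.
case: eqP => [e|_]; last by rewrite mul0r.
case: (ltngtP j i) => [ji|ij|ji].
- by have := cI _ _ ji; rewrite -(before j ji) e ltnn.
- by have := ltn_trans gt (rI _ _ ij); rewrite e ltnn.
- by move: gt; rewrite -e (val_inj ji) ltnn.
Qed.

(** * Generating functions with denominator a power of 1 - x *)

(** Partial sums: multiplication of the generating function by 1 / (1 - x). *)
Definition psum (R : realType) (u : nat -> R) (k : nat) : R :=
  \sum_(0 <= l < k.+1) u l.

(** The coefficients of the power series P(x) / (1 - x)^b. *)
Definition gf_coef (R : realType) (b : nat) (P : {poly R}) : nat -> R :=
  iter b (@psum R) (fun k => P`_k).

Lemma psum0 (R : realType) (u : nat -> R) : psum u 0%N = u 0%N.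
Proof. by rewrite /psum big_nat1. Qed.

Lemma psumS (R : realType) (u : nat -> R) k : psum u k.+1 = psum u k + u k.+1.
Proof. by rewrite /psum big_nat_recr. Qed.

Lemma psum_unique (R : realType) (u w : nat -> R) :
  w 0%N = u 0%N -> (forall k, w k.+1 = w k + u k.+1) -> w =1 psum u.
Proof. by move=> w0 wS; elim=> [|k IH]; rewrite ?psum0 // psumS wS IH. Qed.

Lemma eq_psum (R : realType) (u w : nat -> R) : u =1 w -> psum u =1 psum w.
Proof. by move=> e k; apply: eq_bigr => l _. Qed.

Lemma gf_coef0E (R : realType) (P : {poly R}) k : gf_coef 0 P k = P`_k.
Proof. by []. Qed.

Lemma gf_coefSE (R : realType) b (P : {poly R}) k :
  gf_coef b.+1 P k = psum (gf_coef b P) k.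
Proof. by []. Qed.

Lemma gf_coefD (R : realType) b (P Q : {poly R}) k :
  gf_coef b (P + Q) k = gf_coef b P k + gf_coef b Q k.
Proof.
elim: b k => [|b IH] k; first by rewrite !gf_coef0E coefD.
by rewrite !gf_coefSE (eq_psum IH) /psum big_split.
Qed.

Lemma gf_coefX0 (R : realType) b (P : {poly R}) : gf_coef b ('X * P) 0%N = 0.
Proof. by elim: b => [|b IH]; rewrite ?gf_coef0E ?coefXM // gf_coefSE psum0. Qed.

Lemma gf_coefXS (R : realType) b (P : {poly R}) k :
  gf_coef b ('X * P) k.+1 = gf_coef b P k.
Proof.
elim: b k => [|b IH] k; first by rewrite !gf_coef0E coefXM.
rewrite !gf_coefSE; elim: k => [|k IHk]; rewrite psumS; last by rewrite IHk IH -psumS.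
by rewrite !psum0 IH gf_coefX0 add0r.
Qed.

Lemma gf_coef_mul1BX (R : realType) b (P : {poly R}) :
  gf_coef b.+1 ((1 - 'X) * P) =1 gf_coef b P.
Proof.
elim: b => [|b IH] k; last by rewrite gf_coefSE (eq_psum IH).
rewrite gf_coefSE; elim: k => [|k IH].
  by rewrite psum0 !gf_coef0E mulrBl mul1r coefB coefXM subr0.
by rewrite psumS IH !gf_coef0E mulrBl mul1r coefB coefXM /=; ring.
Qed.

(** The numerator that arises from P when x d/dx + al is applied to
    P / (1 - x)^b, the denominator becoming (1 - x)^(b + 1). *)
Definition weight_step (R : realType) (al : R) (b : nat) (P : {poly R}) : {poly R} :=
  (1 - 'X) * ('X * P^`() + al *: P) + b%:R *: ('X * P).

Lemma gf_coef_weight_step (R : realType) (al : R) b (P : {poly R}) k :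
  (k%:R + al) * gf_coef b P k = gf_coef b.+1 (weight_step al b P) k.
Proof.
elim: b k => [|b IH] k.
  rewrite /weight_step scale0r addr0 gf_coef_mul1BX !gf_coef0E coefD coefXM coefZ.
  case: k => [|k] /=; first by rewrite !add0r.
  by rewrite coef_deriv -[P`_k.+1 *+ _]mulr_natl mulrDl.
(* Both sides are compared through their differences: the difference of
   k |-> (k + al) u_k at k is (k + al) (u_k - u_(k-1)) + u_(k-1), and the last
   term accounts for the extra x P in the numerator. *)
have -> : weight_step al b.+1 P = weight_step al b P + 'X * P.
  by rewrite /weight_step -natr1 scalerDl scale1r addrA.
rewrite [RHS]gf_coefSE.
apply: (psum_unique (w := fun k => (k%:R + al) * gf_coef b.+1 P k)) => [|{}k].
  by rewrite gf_coefSE psum0 gf_coefD -IH gf_coefX0 addr0.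
rewrite gf_coefD -IH gf_coefXS [gf_coef b.+1 P k.+1]gf_coefSE psumS -gf_coefSE.
by rewrite -natr1; ring.
Qed.

(** The binomial series: 1 / (1 - x)^b has coefficients (b)_k / k!. *)
Lemma gf_coef1 (R : realType) b k :
  gf_coef b (1 : {poly R}) k = pochhammer (b%:R : R) k / (k`!)%:R.
Proof.
have poS (x : R) l : pochhammer x l.+1 = pochhammer x l * (x + l%:R).
  by rewrite /pochhammer big_nat_recr.
have fS l : (l.+1`!)%:R = l.+1%:R * (l`!)%:R :> R by rewrite factS natrM.
have f0 l : (l`!)%:R != 0 :> R by rewrite pnatr_eq0 -lt0n fact_gt0.
have po0 (x : R) : pochhammer x 0 = 1 by rewrite /pochhammer big_geq.
have sh (x : R) l : (x + l%:R) * pochhammer x l = x * pochhammer (x + 1) l.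
  elim: l => [|l IH]; first by rewrite !po0 addr0.
  by rewrite !poS [pochhammer x l * _]mulrC IH -natr1; ring.
elim: b k => [|b IH] k.
  rewrite gf_coef0E coef1; case: k => [|k]; first by rewrite po0 divr1.
  suff -> : pochhammer (0 : R) k.+1 = 0 by rewrite mul0r.
  by rewrite /pochhammer big_nat_recl // add0r mul0r.
symmetry; rewrite gf_coefSE.
apply: (psum_unique (w := fun k => pochhammer b.+1%:R k / (k`!)%:R)) => [|{}k].
  by rewrite IH !po0.
rewrite IH fS !poS.
have : (b%:R + k%:R) * pochhammer (b%:R : R) k = b%:R * pochhammer b.+1%:R k.
  by rewrite sh natr1.
rewrite [pochhammer b%:R k * _]mulrC => ->.
have k0 : k.+1%:R != 0 :> R by rewrite pnatr_eq0.
rewrite -![_.+1%:R]natr1 in k0 *; field.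
by rewrite k0 f0.
Qed.

Lemma totally_positive_gf_coef (R : realType) b (P : {poly R}) :
  totally_positive (fun k => P`_k) -> totally_positive (gf_coef b P).
Proof.
move=> tp; elim: b => //= b.
by apply: totally_positive_partial_sum; [exact: psum0 | exact: psumS].
Qed.

Lemma totally_positive_real_rooted (R : realType) (c : R) (s : seq R) :
  0 <= c -> all (fun x => 0 <= x) s ->
  totally_positive (fun k => (c *: \prod_(x <- s) ('X + x%:P))`_k).
Proof.
move=> c0 s0.
apply: (totally_positive_two_term c0 (lexx 0)
          (u := fun k => (\prod_(x <- s) ('X + x%:P))`_k)).
- by rewrite coefZ.
- by move=> k; rewrite coefZ mul0r addr0.
elim: s s0 => [_|x s IH /= /andP[x0 s0]].
  by apply: eq_totally_positive (totally_positive_delta R) => k; rewrite big_nil coef1.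
apply: (totally_positive_two_term x0 ler01) (IH s0) => [|k];
  by rewrite big_cons mulrDl coefD coefXM coefCM /= ?add0r // mul1r addrC.
Qed.

(** * Numerators with simple negative roots *)

(** P has degree d, a positive leading coefficient c, and d distinct negative
    roots, which are the opposites of the entries of s.  The condition
    [path <%R 0 s] says that s is strictly increasing and positive. *)
Definition neg_rooted (R : realType) (d : nat) (P : {poly R}) :=
  exists c : R, exists s : seq R,
    [/\ 0 < c, path <%R 0 s, size s = d & P = c *: \prod_(x <- s) ('X + x%:P)].

(** Q has opposite nonzero signs at -x and -y. *)
Definition alternates (R : realType) (Q : {poly R}) : rel R :=
  fun x y => Q.[- x] * Q.[- y] < 0.

Lemma alternates_roots (R : realType) (Q : {poly R}) (x : R) (s : seq R) :
  path <%R x s -> path (alternates Q) x s ->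
  exists w, [/\ size w = size s, path <%R x w & all (fun y => root Q (- y)) w].
Proof.
elim: s x => [|y s IH] x /=; first by exists [::].
move=> /andP[xy ys] /andP[axy ays].
have [w [sw yw rw]] := IH y ys ays.
have [||z zin rz] := @poly_ivtoo _ Q (- y) (- x); first by rewrite lerN2 ltW.
  by rewrite mulrC; exact: axy.
move: zin; rewrite in_itv /= => /andP[yz zx].
exists (- z :: w); split=> /=; first by rewrite sw.
  apply/andP; split; first by rewrite ltrNr.
  by apply: path_le yw; [exact: lt_trans | rewrite ltrNl].
by rewrite opprK rz.
Qed.

Lemma sign_last_alternates (R : realType) (Q : {poly R}) (x : R) (s : seq R) :
  path (alternates Q) x s -> 0 < Q.[- x] ->
  0 < (-1) ^+ size s * Q.[- last x s].
Proof.
(* The induction runs on a form symmetric in the signs of the two end values;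
   the value at the starting point may only vanish when t is empty. *)
suff H t y : path (alternates Q) y t -> 0 < Q.[- y] * ((-1) ^+ size t * Q.[- last y t])
    \/ Q.[- y] = 0.
  move=> /H[|->]; last by rewrite ltxx.
  by move=> h q; rewrite pmulr_rgt0 in h.
elim: t y => [|z t IH] y /=.
  by move=> _; rewrite expr0 mul1r -expr2; case: (eqVneq Q.[- y] 0) => [|h];
    [right|left; rewrite exprn_even_gt0].
move=> /andP[yz /IH[h|z0]]; last by move: yz; rewrite /alternates z0 mulr0 ltxx.
left; rewrite exprS mulN1r; move: yz h; rewrite /alternates.
set S := (-1) ^+ _ * _; rewrite mulNr -/S.
move: (Q.[- y]) (Q.[- z]) S => p q r; nra.
Qed.

(** A polynomial with as many negative roots as its degree allows is
    determined up to its leading coefficient, whose sign is that of Q(0). *)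
Lemma neg_rooted_of_roots (R : realType) (Q : {poly R}) (w : seq R) :
  path <%R 0 w -> all (fun y => root Q (- y)) w -> (size Q <= (size w).+1)%N ->
  0 < Q.[0] -> neg_rooted (size w) Q.
Proof.
move=> pw rw sQ Q0.
have Qn0 : Q != 0 by apply: contraTneq Q0 => ->; rewrite horner0 ltxx.
have rw' : all (root Q) [seq - y | y <- w] by rewrite all_map.
have uw : uniq [seq - y | y <- w].
  by rewrite (map_inj_uniq oppr_inj); apply/lt_sorted_uniq/path_sorted/pw.
have sE : size Q = (size [seq - y | y <- w]).+1.
  by apply/eqP; rewrite eqn_leq max_poly_roots // size_map sQ.
have := all_roots_prod_XsubC sE rw'; rewrite uniq_rootsE => /(_ uw).
rewrite big_map => QE.
have {}QE : Q = lead_coef Q *: \prod_(x <- w) ('X + x%:P).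
  by rewrite {1}QE; congr (_ *: _); apply: eq_bigr => x _; rewrite polyCN opprK.
exists (lead_coef Q), w; split=> //.
move: Q0; rewrite {1}QE hornerZ horner_prod pmulr_lgt0 //.
move: pw; rewrite lt_path_sortedE => /andP[/allP w0 _].
by rewrite big_seq; apply: prodr_gt0 => x /w0; rewrite !hornerE.
Qed.

Lemma prod_gt0_left (R : realType) (x : R) (s : seq R) (t : R) :
  path <%R x s -> t <= x -> 0 < (\prod_(z <- s) ('X + z%:P)).[- t].
Proof.
rewrite lt_path_sortedE => /andP[/allP w0 _] tx.
rewrite horner_prod big_seq; apply: prodr_gt0 => z /w0 /= xz.
by rewrite !hornerE addrC subr_gt0 (le_lt_trans tx).
Qed.

(** The derivative of a polynomial changes sign between consecutive simple
    roots, hence so does any Q that is a negative multiple of it there.  The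
    factor A collects the roots already passed, so that it keeps a constant
    sign on (-oo, -x]. *)
Lemma alternates_deriv (R : realType) (Q A : {poly R}) (x : R) (s : seq R) :
  let P := A * \prod_(z <- x :: s) ('X + z%:P) in
  0 < x -> path <%R x s ->
  (forall t u, x <= t -> x <= u -> 0 < A.[- t] * A.[- u]) ->
  (forall t, t \in x :: s -> Q.[- t] = - (t * (1 + t)) * P^`().[- t]) ->
  path (alternates Q) x s.
Proof.
elim: s x A => [//|y s IH] x A P x0 /= /andP[xy ys] hA hQ.
have PE : P = (A * ('X + x%:P)) * \prod_(z <- y :: s) ('X + z%:P).
  by rewrite /P big_cons mulrA.
apply/andP; split; last first.
  apply: (IH y (A * ('X + x%:P))) => //; first exact: lt_trans xy.
    move=> t u yt yu; rewrite !(hornerM, hornerD, hornerX, hornerC) mulrACA mulr_gt0 //.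
      by apply: hA; apply: ltW; [exact: lt_le_trans yt | exact: lt_le_trans yu].
    rewrite ![- _ + _]addrC nmulr_rgt0 subr_lt0 ?(lt_le_trans xy yu) //.
    exact: lt_le_trans xy yt.
  by move=> t ts; rewrite -PE; apply: hQ; rewrite in_cons ts orbT.
set B := \prod_(z <- s) ('X + z%:P).
have PE' : P = A * (('X + x%:P) * (('X + y%:P) * B)) by rewrite /P !big_cons.
have Bx : 0 < B.[- x] by apply: prod_gt0_left ys (ltW xy).
have By : 0 < B.[- y] by apply: prod_gt0_left ys _.
have Axy : 0 < A.[- x] * A.[- y] by apply: hA => //; apply: ltW.
have y0 := lt_trans x0 xy.
have dE t : P^`().[- t] = A^`().[- t] * ((x - t) * ((y - t) * B.[- t])) +
    A.[- t] * ((y - t) * B.[- t] + (x - t) * (B.[- t] + (y - t) * B^`().[- t])).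
  rewrite PE' !derivM !derivD !derivX !derivC.
  by rewrite !(hornerM, hornerD, hornerX, hornerC); ring.
have dx : P^`().[- x] = (y - x) * (A.[- x] * B.[- x]) by rewrite dE; ring.
have dy : P^`().[- y] = - ((y - x) * (A.[- y] * B.[- y])) by rewrite dE; ring.
rewrite /alternates !hQ ?inE ?eqxx ?orbT // dx dy.
have -> : - (x * (1 + x)) * ((y - x) * (A.[- x] * B.[- x])) *
    (- (y * (1 + y)) * - ((y - x) * (A.[- y] * B.[- y]))) =
    - ((x * (1 + x)) * (y * (1 + y)) * ((y - x) * (y - x)) *
       (A.[- x] * A.[- y]) * (B.[- x] * B.[- y])) by ring.
move: (A.[- x] * A.[- y]) Axy => AA AA0.
by rewrite oppr_lt0 !mulr_gt0 ?subr_gt0 ?addr_gt0 ?ltr01.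
Qed.

Lemma weight_step_coefS (R : realType) (al : R) b (P : {poly R}) k :
  (weight_step al b P)`_k.+1 = (k.+1%:R + al) * P`_k.+1 + (b%:R - k%:R - al) * P`_k.
Proof.
rewrite /weight_step mulrBl mul1r !(coefB, coefD, coefZ, coefXM) /= coef_deriv.
rewrite -[P`_k.+1 *+ _]mulr_natl; case: k => [|k] /=; first by ring.
by rewrite coef_deriv -[P`_k.+1 *+ _]mulr_natl; ring.
Qed.

Lemma weight_step_horner_root (R : realType) (al : R) b (P : {poly R}) (t : R) :
  root P (- t) -> (weight_step al b P).[- t] = - (t * (1 + t)) * P^`().[- t].
Proof.
move=> /rootP Pt; rewrite /weight_step.
by rewrite !(hornerM, hornerD, hornerN, hornerX, hornerC, hornerZ) Pt; ring.
Qed.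

(** The key step: the shape of the numerator is kept as long as the weight does
    not exceed the level b - d. *)
Lemma neg_rooted_step (R : realType) (al : R) b d (P : {poly R}) :
  0 < al -> neg_rooted d P ->
  (al = b%:R - d%:R -> neg_rooted d (weight_step al b P)) /\
  (al < b%:R - d%:R -> neg_rooted d.+1 (weight_step al b P)).
Proof.
move=> al0 [c [s [c0 ps sz PE]]]; set Q := weight_step al b P.
have sP : size P = d.+1.
  rewrite PE size_scale ?gt_eqF //.
  have -> : \prod_(x <- s) ('X + x%:P) = \prod_(y <- [seq - x | x <- s]) ('X - y%:P).
    by rewrite big_map; apply: eq_bigr => x _; rewrite polyCN opprK.
  by rewrite size_prod_XsubC size_map sz.
have Pd : P`_d = c.
  have := lead_coefE P; rewrite sP /= => <-; rewrite PE lead_coefZ.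
  rewrite (monicP _) ?mulr1 //; apply: monic_prod => x _; exact: monicXaddC.
have Pbig k : (d < k)%N -> P`_k = 0 by move=> dk; rewrite nth_default ?sP.
have Qd : Q`_d.+1 = (b%:R - d%:R - al) * c.
  by rewrite weight_step_coefS Pd Pbig // mulr0 add0r.
have Qbig k : (d.+1 < k)%N -> Q`_k = 0.
  by case: k => // k dk; rewrite weight_step_coefS !Pbig ?mulr0 ?addr0 // ltnW.
have Q0 : 0 < Q.[0].
  rewrite /Q /weight_step !(hornerM, hornerD, hornerN, hornerX, hornerC, hornerZ).
  rewrite !mul0r mulr0 !add0r addr0 subr0 mul1r mulr_gt0 // PE hornerZ mulr_gt0 //.
  by have := prod_gt0_left ps (lexx 0); rewrite oppr0.
have rootsP t : t \in s -> root P (- t).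
  move=> ts; rewrite PE rootE hornerZ horner_prod (big_rem t) //=.
  by rewrite hornerD hornerX hornerC addNr mul0r mulr0.
have alt : path (alternates Q) 0 s.
  case: s ps sz PE rootsP => //= x s /andP[x0 xs] sz PE rootsP.
  have hQ t : t \in x :: s -> Q.[- t] = - (t * (1 + t)) * P^`().[- t].
    by move=> ts; rewrite /Q weight_step_horner_root //; apply: rootsP.
  apply/andP; split.
    rewrite /alternates oppr0 pmulr_rlt0 // hQ ?inE ?eqxx //.
    rewrite mulNr oppr_lt0 mulr_gt0 ?mulr_gt0 ?addr_gt0 //.
    rewrite PE derivZ hornerZ mulr_gt0 // big_cons derivM derivD derivX derivC.
    rewrite !(hornerM, hornerD, hornerX, hornerC, horner0) addNr mul0r !addr0 mul1r.
    by apply: prod_gt0_left xs _.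
  apply: (@alternates_deriv _ Q c%:P) => // [t u _ _|t ts].
    by rewrite !hornerC mulr_gt0.
  by rewrite mul_polyC -PE; apply: hQ.
split=> hal.
  have [w [sw pw rw]] := alternates_roots ps alt.
  rewrite -sz -sw; apply: neg_rooted_of_roots => //; rewrite sw sz.
  apply/leq_sizeP => j; rewrite leq_eqVlt => /orP[/eqP <-|/Qbig //].
  by rewrite Qd hal subrr mul0r.
have lc0 : 0 < Q`_d.+1 by rewrite Qd mulr_gt0 // subr_gt0.
have sQ : size Q = d.+2.
  apply/eqP; rewrite eqn_leq; apply/andP; split; first exact/leq_sizeP/Qbig.
  by apply: contraTT lc0; rewrite -leqNgt => h; rewrite nth_default ?ltxx.
(* The sign of Q far to the left is (-1)^(d + 1), whereas it is (-1)^d at the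
   leftmost root of P; the point -t witnesses the former. *)
pose F := (-1) ^+ d.+1 *: (Q \Po (- 'X)).
have lF : 0 < lead_coef F.
  rewrite lead_coefZ lead_coef_comp ?size_polyN ?size_polyX // lead_coefN lead_coefX.
  rewrite sQ /= mulrCA -exprD addnn -mul2n exprM sqrrN expr1n expr1n mulr1.
  by rewrite lead_coefE sQ.
have [N hN] := poly_pinfty_gt_lc lF.
pose t := Num.max N (last 0 s + 1).
have Ft : 0 < (-1) ^+ d.+1 * Q.[- t].
  have := lt_le_trans lF (hN t _); rewrite le_max lexx => /(_ isT).
  by rewrite /F hornerZ horner_comp !hornerE.
have tl : last 0 s < t by rewrite lt_max ltrDl ltr01 orbT.
have ps' : path <%R 0 (rcons s t) by rewrite rcons_path ps.
have alt' : path (alternates Q) 0 (rcons s t).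
  rewrite rcons_path alt /= /alternates.
  have := @sign_last_alternates _ Q 0 s alt; rewrite oppr0 sz => /(_ Q0).
  move: Ft; rewrite exprS mulN1r mulNr oppr_gt0 => h1 h2.
  have := nmulr_rlt0 ((-1) ^+ d * Q.[- last 0 s]) h1; rewrite h2.
  by rewrite mulrACA -exprD addnn -mul2n exprM sqrrN expr1n expr1n mul1r mulrC.
have [w [sw pw rw]] := alternates_roots ps' alt'.
have sw' : size w = d.+1 by rewrite sw size_rcons sz.
by rewrite -sw'; apply: neg_rooted_of_roots => //; rewrite sw' sQ.
Qed.

(** * Products of weights *)

(** The level hypothesis is required of the integers n >= b - d that lie below
    some weight, which makes it pass to the tail of the list of weights. *)
Lemma weights_neg_rooted (R : realType) (be : seq R) b d (P : {poly R}) :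
  sorted <=%R be -> all (fun x => 0 < x) be -> (d <= b)%N -> neg_rooted d P ->
  (forall n : nat, (b - d <= n)%N -> has (fun x => n%:R < x) be -> n%:R \in be) ->
  exists b' d' P', neg_rooted d' P' /\
    forall k, gf_coef b P k * \prod_(x <- be) (k%:R + x) = gf_coef b' P' k.
Proof.
elim: be b d P => [|x be IH] b d P /=.
  by move=> _ _ _ hP _; exists b, d, P; split=> // k; rewrite big_nil mulr1.
move=> pbe /andP[x0 be0] db hP lev.
have [heq hlt] := neg_rooted_step b x0 hP.
have prodE k : gf_coef b P k * \prod_(y <- x :: be) (k%:R + y) =
    gf_coef b.+1 (weight_step x b P) k * \prod_(y <- be) (k%:R + y).
  by rewrite big_cons -gf_coef_weight_step; ring.
have bdE : (b - d)%:R = b%:R - d%:R :> R by rewrite natrB.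
have be_ge y : y \in be -> x <= y.
  by move: pbe; rewrite (path_sortedE le_trans) => /andP[/allP h _] /h.
case: (ltgtP x (b%:R - d%:R)) => [lt|gt|eq].
- have [|||b' [d' [P' [h1 h2]]]] := IH b.+1 d.+1 (weight_step x b P) _ be0 _ (hlt lt).
  + exact: path_sorted pbe.
  + by [].
  + move=> n; rewrite subSS => bn hn; have := lev n bn; rewrite hn orbT => /(_ isT).
    rewrite inE => /orP[/eqP nx|//].
    by move: lt; rewrite -nx -bdE ltr_nat ltnNge bn.
  by exists b', d', P'; split=> // k; rewrite prodE.
(* A first weight above the level is impossible: the level itself would then be
   a weight, smaller than the first one. *)
- have := lev (b - d)%N (leqnn _); rewrite bdE gt => /(_ isT).
  rewrite inE => /orP[/eqP e|/be_ge]; first by rewrite e ltxx in gt.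
  by rewrite leNgt gt.
- have [|||b' [d' [P' [h1 h2]]]] := IH b.+1 d (weight_step x b P) _ be0 _ (heq eq).
  + exact: path_sorted pbe.
  + exact: leqW.
  + move=> n; rewrite subSn // => bn hn.
    have := lev n (ltnW bn); rewrite hn orbT => /(_ isT).
    rewrite inE => /orP[/eqP nx|//].
    by move: bn; rewrite -(ltr_nat R) bdE -eq nx ltxx.
  by exists b', d', P'; split=> // k; rewrite prodE.
Qed.

Lemma totally_positive_weights (R : realType) (a : nat) (be : seq R) :
  sorted <=%R be -> all (fun x => 0 < x) be ->
  (forall n : nat, (a <= n)%N -> has (fun x => n%:R < x) be -> n%:R \in be) ->
  totally_positive (fun k : nat =>
    pochhammer (a%:R : R) k / (k`!)%:R * \prod_(x <- be) (k%:R + x)).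
Proof.
move=> sbe be0 lev.
have one : neg_rooted 0 (1 : {poly R}).
  by exists 1, [::]; split; rewrite ?ltr01 // big_nil scale1r.
have [|n|b [d [P [[c [s [c0 ps _ PE]]] h]]]] := weights_neg_rooted (b := a) sbe be0 _ one.
- by [].
- by rewrite subn0; apply: lev.
apply: (eq_totally_positive (u := gf_coef b P)) => [k|]; first by rewrite -h gf_coef1.
apply: totally_positive_gf_coef; rewrite PE.
apply: totally_positive_real_rooted; first exact: ltW.
by move: ps; rewrite lt_path_sortedE => /andP[/allP hs _]; apply/allP => x /hs /ltW.
Qed.

Theorem theorem2 (R : realType) (a : nat) (ha : (1 <= a)%N)
  (m : nat) (hm : (1 <= m)%N) (alpha : nat -> R)
  (halpha0 : 0 <= alpha 1%N)
  (halpha_mono : forall i : nat, (1 <= i)%N -> (i < m)%N ->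
     alpha i <= alpha i.+1)
  (halpha_incl : forall n : nat, (1 <= n)%N ->
     a%:R <= n%:R :> R -> n%:R < alpha m ->
     exists i : nat, [/\ (1 <= i)%N, (i <= m)%N & n%:R = alpha i]) :
  totally_positive (fun k : nat =>
    pochhammer (a%:R : R) k / (k`!)%:R
      * \prod_(1 <= i < m.+1) (k%:R + alpha i)).
Proof.
have mono i j : (1 <= i)%N -> (i <= j)%N -> (j <= m)%N -> alpha i <= alpha j.
  move=> i1; elim: j => [|j IH]; first by case: i i1.
  rewrite leq_eqVlt => /orP[/eqP <- //|]; rewrite ltnS => ij jm.
  by apply: le_trans (IH ij (ltnW jm)) (halpha_mono _ (leq_trans i1 ij) jm).
have srt (t : R) p : (1 <= p)%N ->
    sorted <=%R [seq alpha i + t | i <- index_iota p m.+1].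
  move=> p1; apply/(sortedP 0) => i; rewrite size_map size_iota => im.
  rewrite !(nth_map 0%N) ?size_iota //; last exact: ltnW.
  rewrite !nth_iota //; last exact: ltnW.
  by rewrite lerD2r; apply: mono; lia.
case: (eqVneq (alpha 1%N) 0) => [al0|al0].
  (* The weight k + 0 cancels against k!, leaving a times the shift of the
     sequence attached to a + 1 and the weights alpha_i + 1 for i >= 2. *)
  have tp : totally_positive (fun k : nat => pochhammer (a.+1%:R : R) k / (k`!)%:R
      * \prod_(x <- [seq alpha i + 1 | i <- index_iota 2 m.+1]) (k%:R + x)).
    apply: totally_positive_weights; first exact: srt.
      apply/allP => x /mapP[i]; rewrite mem_index_iota => im ->.
      by rewrite ltr_wpDl // (le_trans halpha0) // mono //; lia.
    case=> // n an /hasP[x /mapP[i]]; rewrite mem_index_iota => im ->.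
    rewrite -natr1 ltrD2r => ni.
    have [|||j [j1 jm nj]] := halpha_incl n.
    - by lia.
    - by rewrite ler_nat.
    - by apply: lt_le_trans ni _; apply: mono; lia.
    rewrite nj; apply/mapP; exists j => //; rewrite mem_index_iota.
    case: (eqVneq j 1%N) => [j1'|]; last by lia.
    by move/eqP: nj; rewrite j1' al0 pnatr_eq0; lia.
  apply: (totally_positive_two_term (lexx 0) (ler0n R a)) tp => [|k].
    by rewrite big_ltn // al0 addr0 mul0r mulr0 mul0r.
  rewrite mul0r add0r big_ltn // al0 addr0 big_map /pochhammer big_nat_recl // addr0.
  rewrite factS natrM.
  have -> : \prod_(0 <= i < k) (a%:R + i.+1%:R) = \prod_(0 <= i < k) (a.+1%:R + i%:R) :> R.
    by apply: eq_bigr => i _; rewrite -!natr1; ring.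
  have -> : \prod_(2 <= i < m.+1) (k.+1%:R + alpha i) =
      \prod_(2 <= i < m.+1) (k%:R + (alpha i + 1)).
    by apply: eq_bigr => i _; rewrite -natr1; ring.
  set A := \prod_(0 <= i < k) _; set B := \prod_(2 <= i < _) _.
  have f0 : (k`!)%:R != 0 :> R by rewrite pnatr_eq0 -lt0n fact_gt0.
  have k0 : k.+1%:R != 0 :> R by rewrite pnatr_eq0.
  by move: A B (k`!%:R : R) (k.+1%:R : R) f0 k0 => A B f q f0 q0; field; rewrite f0 q0.
apply: (eq_totally_positive (u := fun k => pochhammer a%:R k / (k`!)%:R *
    \prod_(x <- [seq alpha i + 0 | i <- index_iota 1 m.+1]) (k%:R + x))) => [k|].
  by rewrite big_map; congr (_ * _); apply: eq_bigr => i _; rewrite addr0.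
apply: totally_positive_weights; first exact: srt.
  apply/allP => x /mapP[i]; rewrite mem_index_iota => /andP[i1 im] ->.
  by rewrite addr0; apply: lt_le_trans (mono _ _ _ i1 im); rewrite // lt_neqAle eq_sym al0.
move=> n an /hasP[x /mapP[i]]; rewrite mem_index_iota => /andP[i1 im] ->.
rewrite addr0 => ni.
have [|||j [j1 jm ->]] := halpha_incl n.
- exact: leq_trans an.
- by rewrite ler_nat.
- exact: lt_le_trans ni (mono _ _ i1 im (leqnn _)).
by apply/mapP; exists j; rewrite ?addr0 // mem_index_iota j1.
Qed.
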